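(* Let $X$ be a compact metric space of negative type. Then $$|X|_+ = \sup\{|Y| : Y\subseteq X \text{ closed and positively weighted}\},$$ and this supremum is attained when $Y$ is the support of the diversity-maximizing measure of $X$.
   Context: For a compact metric space $(Y,d)$: $Z(x,y)=e^{-d(x,y)}$; $\mathscr{M}(Y)$ = finite signed Borel measures, $\mathscr{P}(Y)$ = Borel probability measures; $\langle\mu,\nu\rangle_{\mathscr{W}}=\int\int Z(x,y)\,\mu(dx)\nu(dy)$. $Y$ is of negative type if $(Y,\sqrt d)$ embeds isometrically into a Hilbert space (closed subsets of a negative-type space are of negative type); then $\langle\cdot,\cdot\rangle_{\mathscr W}$ is an inner product on $\mathscr{M}(Y)$ with norm $\|\cdot\|_{\mathscr W}$. Maximum diversity: $|Y|_+=\sup_{\mu\in\mathscr{P}(Y)}1/\langle\mu,\mu\rangle_{\mathscr W}$, attained by a unique diversity-maximizing measure when $Y$ is of negative type. Magnitude: $|Y|=\sup\{1/\|\mu\|_{\mathscr W}^2:\mu\in\mathscr M(Y),\ \mu(Y)=1\}$. $Y$ is positively weighted if this supremum is attained at some probability measure $\mu\in\mathscr{P}(Y)$ (equivalently, there is a nonnegative measure $w$ on $Y$ with $\int_Y e^{-d(x,y)}w(dy)=1$ for all $x\in Y$). *)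

(* Defs.v *)
From HB Require Import structures.
From mathcomp Require Import all_boot all_order all_algebra.
From mathcomp Require Import all_classical all_reals all_analysis.
Set Implicit Arguments. Unset Strict Implicit. Unset Printing Implicit Defensive.
Import Order.TTheory GRing.Theory Num.Theory.
Local Open Scope classical_set_scope.
Local Open Scope ring_scope.

Section MetricDefs.
Variables (R : realType) (T : pointedType) (d : T -> T -> R).

Definition is_metric : Prop :=
  (forall x y, 0 <= d x y) /\ (forall x y, d x y = 0 <-> x = y) /\
  (forall x y, d x y = d y x) /\ (forall x y z, d x z <= d x y + d y z).

Definition dball (x : T) (e : R) : set T := [set y | d x y < e].
Definition d_open (A : set T) : Prop :=
  forall x, A x -> exists e : R, 0 < e /\ dball x e `<=` A.
Definition d_closed (A : set T) : Prop := d_open (~` A).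

Definition d_compact : Prop :=
  forall (I : Type) (U : I -> set T), (forall i, d_open (U i)) ->
    (forall x, exists i, U i x) ->
    exists (n : nat) (f : 'I_n -> I), forall x, exists k, U (f k) x.

Definition is_inner_product (V : lmodType R) (ip : V -> V -> R) : Prop :=
  (forall u v, ip u v = ip v u) /\
  (forall (a : R) u v w, ip (a *: u + v) w = a * ip u w + ip v w) /\
  (forall u, 0 <= ip u u) /\ (forall u, ip u u = 0 -> u = 0).
Definition ipnorm (V : lmodType R) (ip : V -> V -> R) (u : V) : R :=
  Num.sqrt (ip u u).
Definition ip_complete (V : lmodType R) (ip : V -> V -> R) : Prop :=
  forall u : nat -> V,
    (forall e : R, 0 < e -> exists N, forall m n, (N <= m)%N -> (N <= n)%N ->
        ipnorm ip (u m - u n) < e) ->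
    exists l : V, forall e : R, 0 < e -> exists N, forall n, (N <= n)%N ->
        ipnorm ip (u n - l) < e.

Definition negative_type : Prop :=
  exists (V : lmodType R) (ip : V -> V -> R) (phi : T -> V),
    is_inner_product ip /\ ip_complete ip /\
    forall x y, ipnorm ip (phi x - phi y) = Num.sqrt (d x y).

End MetricDefs.

Notation Borel d := (g_sigma_algebraType (d_open d)).

Section Weighting.
Variables (R : realType) (T : pointedType) (d : T -> T -> R).

Definition Wpos (mu nu : {finite_measure set Borel d -> \bar R}) : R :=
  fine (\int[mu]_x \int[nu]_y (expR (- d x y))%:E)%E.

(* A finite signed Borel measure, represented by a pair (mu+, mu-) of finite
   Borel measures: it denotes mu+ - mu-. *)
Definition signed_measure :=
  ({finite_measure set Borel d -> \bar R} * {finite_measure set Borel d -> \bar R})%type.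

Definition smass (m : signed_measure) : R :=
  fine (m.1 setT) - fine (m.2 setT).

(* bilinear extension of <.,.>_W to signed measures *)
Definition W (m n : signed_measure) : R :=
  Wpos m.1 n.1 - Wpos m.1 n.2 - Wpos m.2 n.1 + Wpos m.2 n.2.

Definition on_set (Y : set T) (m : signed_measure) : Prop :=
  m.1 (~` Y) = 0%E /\ m.2 (~` Y) = 0%E.

Definition magnitude (Y : set T) : \bar R :=
  ereal_sup [set ((W m m)^-1)%:E | m in [set m | on_set Y m /\ smass m = 1]].

Definition prob_on (Y : set T) (P : probability (Borel d) R) : Prop :=
  P (~` Y) = 0%E.

Definition Wprob (P Q : probability (Borel d) R) : R :=
  fine (\int[P]_x \int[Q]_y (expR (- d x y))%:E)%E.

Definition max_diversity : \bar R :=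
  ereal_sup [set ((Wprob P P)^-1)%:E | P in [set: probability (Borel d) R]].

Definition diversity_maximizing (P : probability (Borel d) R) : Prop :=
  ((Wprob P P)^-1)%:E = max_diversity.

Definition positively_weighted (Y : set T) : Prop :=
  exists P : probability (Borel d) R, prob_on Y P /\
    ((Wprob P P)^-1)%:E = magnitude Y.

Definition msupport (P : probability (Borel d) R) : set T :=
  [set x | forall e : R, 0 < e -> (0 < P (dball d x e))%E].

End Weighting.

(* Main.v *)
Require Import Defs.
From HB Require Import structures.
From mathcomp Require Import all_boot all_order all_algebra.
From mathcomp Require Import all_classical all_reals all_analysis.
From mathcomp Require Import measurable_realfun ring lra.
Import Order.TTheory GRing.Theory Num.Theory.
Import numFieldNormedType.Exports.
Local Open Scope classical_set_scope.
Local Open Scope ring_scope.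

(* Let [q] be the energy [<P, P>_W] of a probability measure [P] whose potential
   [h x = int exp (- d x y) P(dy)] is [P]-almost everywhere at least [q].  As [q]
   is the [P]-average of [h] and [h] is continuous, [h = q] on the support [Y] of
   [P].  Hence [<m, P>_W = q] for every signed measure [m] on [Y] of mass 1, and
   [0 <= <m - P, m - P>_W = <m, m>_W - q]: [P] realises the magnitude of [Y].

   A diversity-maximizing [P] satisfies the hypothesis by the first variation
   along [(1 - t) P + t delta_x].  For the supremum formula no maximizer (hence no
   weak compactness) is needed: [P] is approximated by a measure on a finite
   [e]-net, whose energy is bounded below by that of the minimizer on the net, and
   the support of that minimizer is positively weighted by the same argument.

   Positive semidefiniteness of [<., .>_W], and its symmetry, are likewise
   transferred from finite nets, where they say that [exp (- |u - v|^2)] is a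
   positive semidefinite kernel on a Hilbert space. *)

(** * Positive semidefinite kernels *)

Definition psd {R : realType} {I : finType} (K : I -> I -> R) : Prop :=
  forall c : I -> R, 0 <= \sum_i \sum_j c i * c j * K i j.

Lemma sum_kronecker {R : realType} {I : finType} (f : I -> R) (i : I) :
  \sum_j f j * (j == i)%:R = f i.
Proof.
rewrite (bigD1 i) //= eqxx mulr1 big1 ?addr0 // => j /negPf ->.
by rewrite mulr0.
Qed.

(** Second-order expansion along the [k]-th coordinate. It serves both the semidefinite kernels and
    the first variation on the simplex. *)
Lemma quadratic_shift {R : realType} {I : finType} (G : I -> I -> R)
    (c : I -> R) (t : R) (k : I) : (forall i j, G i j = G j i) ->
  \sum_i \sum_j (c i + t * (i == k)%:R) * (c j + t * (j == k)%:R) * G i j =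
  \sum_i \sum_j c i * c j * G i j + 2 * t * (\sum_j c j * G k j) + t ^+ 2 * G k k.
Proof.
move=> Gsym.
have inner i : \sum_j (c i + t * (i == k)%:R) * (c j + t * (j == k)%:R) * G i j
    = \sum_j c i * c j * G i j + t * (c i * G k i)
      + (t * (\sum_j c j * G i j) + t ^+ 2 * G i k) * (i == k)%:R.
  have -> : \sum_j (c i + t * (i == k)%:R) * (c j + t * (j == k)%:R) * G i j =
    (c i + t * (i == k)%:R) *
      (\sum_j c j * G i j + \sum_j (t * G i j) * (j == k)%:R).
    by rewrite -big_split mulr_sumr; apply: eq_bigr => j _ /=; ring.
  have -> : \sum_j c i * c j * G i j = c i * \sum_j c j * G i j.
    by rewrite mulr_sumr; apply: eq_bigr => j _; rewrite mulrA.
  by rewrite sum_kronecker (Gsym k i); ring.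
rewrite (eq_bigr _ (fun i _ => inner i)) !big_split /=.
rewrite sum_kronecker -mulr_sumr; ring.
Qed.

Lemma psd_shift {R : realType} {I : finType} (G : I -> I -> R) (k : I) (c : I -> R) (t : R) :
  (forall i j, G i j = G j i) -> psd G ->
  0 <= \sum_i \sum_j c i * c j * G i j + 2 * t * (\sum_j c j * G k j) + t ^+ 2 * G k k.
Proof. by move=> Gsym Gpsd; rewrite -quadratic_shift. Qed.

Lemma psd_diag_ge0 {R : realType} {I : finType} (G : I -> I -> R) (k : I) :
  (forall i j, G i j = G j i) -> psd G -> 0 <= G k k.
Proof.
move=> Gsym Gpsd; have := psd_shift _ k (fun=> 0) 1 Gsym Gpsd.
rewrite big1 => [|i _]; last by rewrite big1 // => j _; rewrite !mul0r.
by rewrite big1 => [|j _]; rewrite ?mul0r // mulr0 !add0r expr1n mul1r.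
Qed.

(** When [G k k = 0] the form is affine in the shift along [k]; a nonzero slope would make it
    negative somewhere. *)
Lemma psd_diag0 {R : realType} {I : finType} (G : I -> I -> R) (k j : I) :
  (forall i j, G i j = G j i) -> psd G -> G k k = 0 -> G k j = 0.
Proof.
move=> Gsym Gpsd Gk0.
pose c (i : I) : R := (i == j)%:R.
have L : \sum_i c i * G k i = G k j.
  by rewrite -[RHS](sum_kronecker (G k)); apply: eq_bigr => i _; rewrite mulrC.
pose Q := \sum_i \sum_j c i * c j * G i j.
apply/eqP/negPn/negP => L0.
(* This shift brings the form down to [-1]. *)
have := psd_shift _ k c (- (Q + 1) / (2 * G k j)) Gsym Gpsd.
rewrite Gk0 L -/Q mulr0 addr0.
have -> : 2 * (- (Q + 1) / (2 * G k j)) * G k j = - (Q + 1) by field.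
by rewrite opprD addrA subrr sub0r oppr_ge0 ler10.
Qed.

(* Schur product theorem, by peeling off one rank-one term of [G] per step *)
Lemma psd_mul {R : realType} {I : finType} (K G : I -> I -> R) :
  (forall i j, G i j = G j i) -> psd K -> psd G ->
  psd (fun i j => K i j * G i j).
Proof.
(* Induction on a bound for the number of nonzero diagonal entries of [G]; if there are none,
   [psd_diag0] gives [G = 0]. *)
move=> + Kpsd; move: {2}(#|_|) (leqnn #|[pred i | G i i != 0]|) => n.
elim: n G => [|n IH] G cardG Gsym Gpsd c.
  rewrite big1 // => i _; rewrite big1 // => j _.
  rewrite (psd_diag0 G i j) ?mulr0 //; apply/eqP/negPn/negP => Gi.
  by move: cardG; rewrite leqn0 => /eqP/card0_eq/(_ i); rewrite !inE Gi.
have [k /= Gk0|/eq_card0 G0] := pickP [pred i | G i i != 0]; last first.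
  by apply: IH => //; rewrite G0.
have Gk : 0 < G k k by rewrite lt_def Gk0 psd_diag_ge0.
(* Schur complement of the pivot [G k k]: its row [k] vanishes, which lowers the count. *)
pose G' i j := G i j - G k i * G k j / G k k.
have G'sym i j : G' i j = G' j i by rewrite /G' Gsym (mulrC (G k i)).
have G'psd : psd G'.
  move=> b; pose L := \sum_j b j * G k j.
  (* The shift [- L / G k k] minimizes the quadratic in [t], and the minimum is the form of [G'] at
     [b]. *)
  have := psd_shift _ k b (- L / G k k) Gsym Gpsd; rewrite -/L.
  congr (0 <= _).
  rewrite -addrA.
  have -> : 2 * (- L / G k k) * L + (- L / G k k) ^+ 2 * G k k = - (L * L / G k k) by field.
  rewrite {1}/L !mulr_suml -sumrB; apply: eq_bigr => i _.
  rewrite -mulrA mulr_suml mulr_sumr -sumrB; apply: eq_bigr => j _.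
  by rewrite /G'; ring.
have cardG' : (#|[pred i | G' i i != 0%R]| <= n)%N.
  rewrite -ltnS (leq_trans _ cardG) //; apply: proper_card; apply/properP; split.
    apply/fintype.subsetP => i; rewrite !inE; apply: contra => /eqP Gi.
    by rewrite /G' Gi (Gsym k i) (psd_diag0 G i k) // !mul0r subrr.
  by exists k; rewrite !inE // /G' mulfK // subrr eqxx.
have := IH G' cardG' G'sym G'psd c.
(* The removed rank-one term contributes the form of [K] at [c i * G k i], divided by the pivot. *)
have := Kpsd (fun i => c i * G k i); rewrite -(@pmulr_lge0 _ (G k k)^-1) ?invr_gt0 // => h1 h2.
have := addr_ge0 h1 h2; congr (0 <= _).
rewrite mulr_suml -big_split /=; apply: eq_bigr => i _.
rewrite mulr_suml -big_split /=; apply: eq_bigr => j _.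
by rewrite /G'; ring.
Qed.

Lemma psd_pow {R : realType} {I : finType} (G : I -> I -> R) (n : nat) :
  (forall i j, G i j = G j i) -> psd G -> psd (fun i j => G i j ^+ n).
Proof.
move=> Gsym Gpsd; elim: n => [|n IH] c; last first.
  have := psd_mul _ _ Gsym IH Gpsd c; congr (0 <= _).
  by apply: eq_bigr => i _; apply: eq_bigr => j _; rewrite exprSr.
have := sqr_ge0 (\sum_i c i); congr (0 <= _).
rewrite expr2 mulr_suml; apply: eq_bigr => i _.
by rewrite mulr_sumr; apply: eq_bigr => j _; rewrite expr0 mulr1.
Qed.

(** Partial sums of the exponential series are nonnegative combinations of entrywise powers of [G],
    and nonnegativity passes to the limit. *)
Lemma psd_expR {R : realType} {I : finType} (G : I -> I -> R) :
  (forall i j, G i j = G j i) -> psd G -> psd (fun i j => expR (G i j)).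
Proof.
move=> Gsym Gpsd c.
pose u n := \sum_i \sum_j c i * c j * series (exp_coeff (G i j)) n.
have ucvg : u @ \oo --> \sum_i \sum_j c i * c j * expR (G i j).
  apply: cvg_big => [|i _]; first exact: add_continuous.
  apply: cvg_big => [|j _]; first exact: add_continuous.
  by apply: cvgMl_tmp; exact: is_cvg_series_exp_coeff.
rewrite -(cvg_lim (@Rhausdorff R) ucvg); apply: limr_ge.
  by apply/cvg_ex; exists (\sum_i \sum_j c i * c j * expR (G i j)).
near=> n.
have -> : u n = \sum_(0 <= k < n)
    (k`!%:R^-1 * \sum_i \sum_j c i * c j * G i j ^+ k).
  rewrite /u; under eq_bigr do under eq_bigr do rewrite mulr_sumr.
  under eq_bigr do rewrite exchange_big.
  rewrite exchange_big; apply: eq_bigr => k _; rewrite mulr_sumr.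
  apply: eq_bigr => i _; rewrite mulr_sumr; apply: eq_bigr => j _ /=.
  by rewrite /exp_coeff /=; ring.
by apply: sumr_ge0 => k _; rewrite mulr_ge0 ?invr_ge0 //; exact: psd_pow.
Unshelve. all: by end_near. Qed.

Lemma psd_gram {R : realType} {V : lmodType R} (ip : V -> V -> R) {I : finType}
    (v : I -> V) : is_inner_product ip -> psd (fun i j => ip (v i) (v j)).
Proof.
move=> [ipC [ipL [ip_ge0 _]]] c.
have ip0 w : ip 0 w = 0.
  by have := ipL 1 0 0 w; rewrite scaler0 addr0 mul1r; lra.
have ip_sum w : ip (\sum_i c i *: v i) w = \sum_i c i * ip (v i) w.
  by apply: (big_ind2 (fun a b => ip a w = b)) => // [a b x y|i _];
    [move=> <- <-; rewrite -[a]scale1r ipL mul1r scale1r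
    |rewrite -[_ *: _]addr0 ipL ip0 addr0].
have := ip_ge0 (\sum_i c i *: v i); congr (0 <= _).
rewrite ip_sum; apply: eq_bigr => i _.
rewrite ipC ip_sum mulr_sumr; apply: eq_bigr => j _.
by rewrite (ipC (v i)) mulrA.
Qed.

(* [exp (- |u - v|^2) = exp (- |u|^2) exp (- |v|^2) exp (2 <u, v>)] *)
Lemma psd_expRN_negative_type {R : realType} {T : pointedType}
    (d : T -> T -> R) {I : finType} (x : I -> T) :
  is_metric d -> negative_type d -> psd (fun i j => expR (- d (x i) (x j))).
Proof.
move=> [d_ge0 _] [V [ip [phi [ipP [_ phiE]]]]] c.
have [ipC [ipL [ip_ge0 _]]] := ipP.
have dE a b : d a b = ip (phi a) (phi a) + ip (phi b) (phi b) - 2 * ip (phi a) (phi b).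
  have /eqP := phiE a b; rewrite /ipnorm eqr_sqrt // => /eqP <-.
  have ipB u v w : ip (u - v) w = ip u w - ip v w.
    by rewrite addrC -scaleN1r ipL; ring.
  by rewrite ipB !(ipC _ (_ - _)) !ipB (ipC (phi b) (phi a)); ring.
pose G i j := 2 * ip (phi (x i)) (phi (x j)).
have Gpsd : psd G.
  move=> b; have := psd_gram ip (phi \o x) ipP b.
  rewrite -(@pmulr_rge0 _ 2) //; congr (0 <= _).
  by rewrite mulr_sumr; apply: eq_bigr => i _; rewrite mulr_sumr;
    apply: eq_bigr => j _; rewrite /G /=; ring.
have Gsym i j : G i j = G j i by rewrite /G ipC.
pose e i := expR (- ip (phi (x i)) (phi (x i))).
have := psd_expR G Gsym Gpsd (fun i => c i * e i); congr (0 <= _).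
apply: eq_bigr => i _; apply: eq_bigr => j _.
rewrite dE /G !opprD opprK !expRD /e; ring.
Qed.

(** * Quadratic forms on the simplex *)

Definition in_simplex {R : realType} {n} (p : 'I_n -> R) : Prop :=
  (forall i, 0 <= p i) /\ \sum_i p i = 1.

Lemma in_simplex_le1 {R : realType} {n} (p : 'I_n -> R) i : in_simplex p -> p i <= 1.
Proof.
by move=> [p0 <-]; rewrite (bigD1 i) //= lerDl sumr_ge0.
Qed.

(** Extreme value theorem on the simplex, a closed subset of a cube. The point [p0] ensures that the
    simplex is nonempty, which fails for [n = 0]. *)
Lemma ex_simplex_min {R : realType} {n} (K : 'I_n -> 'I_n -> R) (p0 : 'I_n -> R) :
  in_simplex p0 -> exists2 p, in_simplex p & forall p', in_simplex p' ->
    \sum_i \sum_j p i * p j * K i j <= \sum_i \sum_j p' i * p' j * K i j.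
Proof.
move=> sp0.
pose S : set 'rV[R]_n := [set v | in_simplex (fun i => v ord0 i)].
have toS p : in_simplex p -> S (\row_i p i).
  move=> sp; rewrite /S /=.
  by have -> : (fun i => (\row_i p i) ord0 i) = p by apply/funext => i; rewrite mxE.
have cont_coord i : continuous (fun v : 'rV[R]_n => v ord0 i) by exact: coord_continuous.
have S_compact : compact S.
  have cube_compact : compact [set v : 'rV[R]_n | forall i, v ord0 i \in `[0, 1]].
    have h := @rV_compact R n (fun=> `[0, 1]%classic). 
    exact: h (fun=> @segment_compact R 0 1).
  have -> : S = [set v : 'rV[R]_n | forall i, v ord0 i \in `[0, 1]] `&`
      (fun v : 'rV[R]_n => \sum_i v ord0 i) @^-1` [set 1].
    apply/seteqP; split => v /=.
      move=> sv; split; last exact: sv.2.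
      by move=> i; rewrite /= in_itv /= sv.1 (in_simplex_le1 _ i sv).
    by move=> [v01 v1]; split => // i; have := v01 i; rewrite /= in_itv /= => /andP[].
  apply: compact_closedI => //.
  apply: preimage_closed; last exact: closed_eq.
  by move=> v _; apply: continuous_big => [|i _]; [exact: add_continuous|exact: cont_coord].
have cont_term i j : continuous (fun v : 'rV[R]_n => v ord0 i * v ord0 j * K i j).
  move=> v.
  apply: (@continuousM R 'rV[R]_n (fun v : 'rV[R]_n => v ord0 i * v ord0 j) (cst (K i j)));
    last exact: cst_continuous.
  by apply: (@continuousM R 'rV[R]_n (fun v : 'rV[R]_n => v ord0 i) (fun v => v ord0 j)); exact: cont_coord.
pose F (v : 'rV[R]_n) := \sum_i \sum_j v ord0 i * v ord0 j * K i j.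
have F_cont : continuous F.
  apply: continuous_big => [|i _]; first exact: add_continuous.
  apply: continuous_big => [|j _]; first exact: add_continuous.
  exact: cont_term.
have [v Sv vmin] := EVT_min_rV (ex_intro S _ (toS _ sp0)) S_compact
  (continuous_subspaceT F_cont).
exists (fun i => v ord0 i) => [|p sp]; first by rewrite inE in Sv.
have := vmin (\row_i p i); rewrite inE => /(_ (toS _ sp)); rewrite /F.
by congr (_ <= _); apply: eq_bigr => i _; apply: eq_bigr => j _; rewrite !mxE.
Qed.

(** The right-hand side is the energy of [(1 - t) P + t delta], where [q] and [c] are the energies
    of [P] and [delta], and [h] is their mutual energy. If [h < q], it drops below [q] for small
    [t]. Stated on numbers, this covers both the simplex and measures. *)
Lemma le_first_variation {R : realType} (q h c : R) :
  (forall t, 0 < t <= 1 -> q <= (1 - t) ^+ 2 * q + 2 * t * (1 - t) * h + t ^+ 2 * c) ->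
  q <= h.
Proof.
move=> var; rewrite leNgt; apply/negP => hq.
set s := q - 2 * h + c.
have s1 : 0 < `|s| + (q - h) by rewrite ltr_wpDl ?subr_gt0.
(* Chosen so that [t <= 1] and [t * s <= q - h], which is less than [2 * (q - h)]. *)
pose t := (q - h) / (`|s| + (q - h)).
have t0 : 0 < t by rewrite divr_gt0 ?subr_gt0.
have t1 : t <= 1 by rewrite ler_pdivrMr // mul1r lerDr.
have ts : t * s < 2 * (q - h).
  apply: (@le_lt_trans _ _ (q - h)); last by lra.
  rewrite mulrAC ler_pdivrMr // ler_pM2l ?subr_gt0 //.
  by rewrite (le_trans (ler_norm s)) // lerDl subr_ge0 ltW.
have := var t; rewrite t0 t1 => /(_ isT).
have -> : (1 - t) ^+ 2 * q + 2 * t * (1 - t) * h + t ^+ 2 * c =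
  q + t * (t * s - 2 * (q - h)) by rewrite /s; ring.
by rewrite lerDl pmulr_rge0 // subr_ge0 leNgt ts.
Qed.

(** First variation of the form at the minimizer [p] towards the vertex [k]. *)
Lemma simplex_min_gradient {R : realType} {n} (K : 'I_n -> 'I_n -> R) (p : 'I_n -> R) k :
  (forall i j, K i j = K j i) -> in_simplex p ->
  (forall p', in_simplex p' ->
    \sum_i \sum_j p i * p j * K i j <= \sum_i \sum_j p' i * p' j * K i j) ->
  \sum_i \sum_j p i * p j * K i j <= \sum_j p j * K k j.
Proof.
move=> Ksym [p0 p1] pmin; apply: (@le_first_variation _ _ _ (K k k)) => t /andP[t0 t1].
have sp : in_simplex (fun i => (1 - t) * p i + t * (i == k)%:R).
  split=> [i|]; first by rewrite addr_ge0 // mulr_ge0 // ?subr_ge0 // ltW.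
  by rewrite big_split /= -mulr_sumr p1 sum_kronecker; lra.
apply: (le_trans (pmin _ sp)); rewrite quadratic_shift //.
have -> : \sum_j (1 - t) * p j * K k j = (1 - t) * \sum_j p j * K k j.
  by rewrite mulr_sumr; apply: eq_bigr => j _; rewrite mulrA.
have -> : \sum_i \sum_j (1 - t) * p i * ((1 - t) * p j) * K i j =
    (1 - t) ^+ 2 * \sum_i \sum_j p i * p j * K i j.
  rewrite mulr_sumr; apply: eq_bigr => i _.
  by rewrite mulr_sumr; apply: eq_bigr => j _; ring.
by rewrite !mulrA.
Qed.

(** * Measures on a compact metric space *)

(** Turns estimates on [e]-nets, with error [e * C] for every [e], into exact identities. *)
Lemma eq0_small {R : realFieldType} (x C : R) :
  (forall e, 0 < e -> `|x| <= e * C) -> x = 0.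
Proof.
move=> h; apply/normr0_eq0/eqP; rewrite eq_le normr_ge0 andbT.
have C0 : 0 <= C by rewrite -[C]mul1r (le_trans _ (h 1 _)).
apply/ler_addgt0Pr => e e0; rewrite add0r.
have C1 : 0 < C + 1 by lra.
rewrite (le_trans (h (e / (C + 1)) _)) ?divr_gt0 //.
by rewrite mulrAC ler_pdivrMr // ler_pM2l //; lra.
Qed.

Lemma expRN_lip {R : realType} (a b : R) : 0 <= a -> 0 <= b ->
  `|expR (- a) - expR (- b)| <= `|a - b|.
Proof.
wlog ab : a b / a <= b.
  move=> H a0 b0; case/orP: (le_total a b) => ab; first exact: H.
  by rewrite distrC (distrC a); exact: H.
move=> a0 b0; rewrite ger0_norm ?subr_ge0 ?ler_expR ?lerN2 //.
rewrite distrC ger0_norm ?subr_ge0 //.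
have -> : expR (- b) = expR (- a) * expR (- (b - a)).
  by rewrite -expRD; congr expR; ring.
have h1 := expR_ge1Dx (- (b - a)).
have h2 : expR (- a) <= 1 by rewrite -expR0 ler_expR oppr_le0.
have h3 := expR_gt0 (- a).
rewrite -[X in X - _]mulr1 -mulrBr.
apply: (@le_trans _ _ (expR (- a) * (b - a))); last by rewrite ler_piMl ?subr_ge0.
by rewrite ler_pM2l //; lra.
Qed.

Lemma ex_mixture {disp : measure_display} {X : measurableType disp} {R : realType} {n}
    (p : 'I_n -> R) (mu : 'I_n -> probability X R) :
  (forall i, 0 <= p i) -> \sum_i p i = 1 ->
  exists Q : probability X R, forall A, measurable A ->
    fine (Q A) = \sum_i p i * fine (mu i A).
Proof.
move=> p0 p1.
(* [msum] takes a sequence indexed by [nat], so indices from [n] on get the zero measure. *)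
pose nu_ (k : nat) : {measure set X -> \bar R} :=
  if insub k is Some i then mscale (NngNum (p0 i)) (mu i) else mzero.
have nuE A : msum nu_ n A = (\sum_i (p i)%:E * mu i A)%E.
  by rewrite /msum; apply: eq_bigr => i _; rewrite /nu_ valK.
have nuT : msum nu_ n setT = 1%E.
  rewrite nuE -[1%E]/(1%:E) -p1 -sumEFin; apply: eq_bigr => i _.
  by rewrite probability_setT mule1.
(* The total mass is already 1: normalizing changes nothing and only supplies the probability
   structure. *)
exists (mnormalize (msum nu_ n) (\d_point)) => A mA.
have QE : mnormalize (msum nu_ n) \d_(point : X) A = msum nu_ n A.
  by rewrite /mnormalize /= nuT onee_eq0 /= invr1 mule1.
rewrite [X in fine X]QE nuE.
rewrite -sum_fine => [|i _]; last by rewrite fin_numM // fin_num_measure.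
by apply: eq_bigr => i _; rewrite fineM // fin_num_measure.
Qed.

Section CompactMetric.
Context {R : realType} {T : pointedType} {d : T -> T -> R}.
Hypotheses (d_metric : is_metric d) (d_cpt : d_compact d).

Let B := Borel d.
Implicit Types (mu nu : {finite_measure set B -> \bar R}).

Let d_ge0 x y : 0 <= d x y. Proof. by case: d_metric. Qed.
Let dxx x : d x x = 0. Proof. by case: d_metric => _ [/(_ x x) [_ ->]]. Qed.
Let dC x y : d x y = d y x. Proof. by case: d_metric => _ [_ []]. Qed.
Let d_tri x y z : d x z <= d x y + d y z.
Proof. by case: d_metric => _ [_ [_]]. Qed.

(** * Finite nets and integrals of Lipschitz functions *)

Lemma dball_open x e : d_open d (dball d x e).
Proof.
move=> y; rewrite /dball /= => xy; exists (e - d x y); split.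
  by rewrite subr_gt0.
move=> z; rewrite /dball /= => yz; rewrite (le_lt_trans (d_tri x y z)) //; lra.
Qed.

Lemma d_open_measurable (A : set T) : d_open d A -> measurable (A : set B).
Proof. by move=> Ao; exact: sub_sigma_algebra. Qed.

(** The fibres of [g] partition the space into measurable cells, the cell of [y] having centre
    [x (g y)]. A cell may be empty and need not contain its centre. *)
Definition net (e : R) (n : nat) (x : 'I_n -> T) (g : T -> 'I_n) : Prop :=
  (forall k, measurable (g @^-1` [set k] : set B)) /\
  forall y, d (x (g y)) y < e.

Lemma ex_net (e : R) : 0 < e -> exists n x g, @net e n x g.
Proof.
move=> e0.
have cov y : exists z, dball d z e y by exists y; rewrite /dball /= dxx.
have [n [x xP]] := d_cpt T (fun x => dball d x e) (fun x => dball_open x e) cov.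
pose k0 y := projT1 (cid (xP y)).
(* Taking the least index of a ball containing [y] makes cell [k] the [k]-th ball minus the earlier
   ones, hence measurable. *)
pose g y := [arg min_(k < k0 y | `[< dball d (x k) e y >]) (k : nat)]%N.
have gP y : dball d (x (g y)) e y /\
    (forall l, dball d (x l) e y -> (g y <= l)%N).
  rewrite /g; case: arg_minnP => [|k /asboolP kP kmin].
    by apply/asboolP; exact: projT2 (cid (xP y)).
  by split => // l lP; apply: kmin; exact/asboolP.
exists n, x, g; split => [k|y]; last by case: (gP y).
have -> : g @^-1` [set k] =
    dball d (x k) e `\` \bigcup_(l in [set l : 'I_n | (l < k)%N]) dball d (x l) e.
  apply/seteqP; split => y /=.
    move=> <-; split; first by case: (gP y).
    by move=> [l /= lk /(proj2 (gP y))]; rewrite leqNgt lk.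
  move=> [yk ynk]; apply/val_inj/eqP; rewrite eqn_leq (proj2 (gP y)) //=.
  rewrite leqNgt; apply/negP => gk; apply: ynk; exists (g y) => //.
  by case: (gP y).
apply: (@measurableD _ B); first by apply: d_open_measurable; exact: dball_open.
apply: (@fin_bigcup_measurable _ B); first exact: finite_finset.
by move=> l _; apply: d_open_measurable; exact: dball_open.
Qed.

Definition lip (c : R) (f : T -> R) : Prop :=
  forall x y, `|f x - f y| <= c * d x y.

Lemma lip_measurable c f : lip c f -> measurable_fun setT (f : B -> R).
Proof.
move=> fL.
apply: (measurability _ (RGenOInfty.measurableE R)) => _ [_ [a ->] <-].
rewrite setTI; apply: d_open_measurable => x; rewrite /= in_itv /= andbT => ax.
(* The sign of [c] is arbitrary; [|c| + 1] is a positive Lipschitz constant in any case. *)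
have c1 : 0 < `|c| + 1 by rewrite ltr_wpDl.
exists ((f x - a) / (`|c| + 1)); split; first by rewrite divr_gt0 ?subr_gt0.
move=> y; rewrite /dball /= in_itv /= andbT ltr_pdivlMr // => xy.
have : f x - f y <= d x y * (`|c| + 1).
  apply: (le_trans (ler_norm _)); apply: (le_trans (fL x y)).
  rewrite mulrC; apply: ler_wpM2l => //.
  by apply: (le_trans (ler_norm _)); rewrite lerDl.
lra.
Qed.

Lemma lip_bounded c f : lip c f -> exists C, forall x, `|f x| <= C.
Proof.
move=> fL; have [n [x [g [_ xg]]]] := @ex_net 1 ltr01.
(* On a net of radius 1, [f] differs from its value at the centre by at most [|c|]; the sum
   dominates each such value. *)
exists (`|c| + \sum_k `|f (x k)|) => y.
have -> : f y = (f y - f (x (g y))) + f (x (g y)) by rewrite subrK.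
apply: (le_trans (ler_normD _ _)); apply: lerD.
  apply: (le_trans (fL _ _)); apply: (le_trans (ler_norm _)).
  rewrite normrM -[leRHS]mulr1 ler_wpM2l // ger0_norm // dC ltW //.
by rewrite (bigD1 (g y)) //= lerDl sumr_ge0.
Qed.

Lemma lip_integrable c f mu : lip c f -> mu.-integrable setT (EFin \o (f : B -> R)).
Proof.
move=> fL; apply: measurable_bounded_integrable => //.
- by rewrite -ge0_fin_numE // fin_num_measure.
- exact: (lip_measurable _ _ fL).
- have [C fC] := lip_bounded _ _ fL.
  exists C; split; first exact: num_real.
  by move=> r /ltW Cr x _; exact: le_trans (fC x) Cr.
Qed.

Lemma net_integral n (g : T -> 'I_n) (a : 'I_n -> R) mu :
  (forall k, measurable (g @^-1` [set k] : set B)) ->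
  mu.-integrable setT (EFin \o (fun y : B => a (g y))) /\
  \int[mu]_y a (g y) = \sum_k a k * fine (mu (g @^-1` [set k])).
Proof.
move=> mg.
have aE y : a (g y) = \sum_k a k * \1_(g @^-1` [set k]) y.
  rewrite (bigD1 (g y)) //= indicE mem_set // mulr1 big1 ?addr0 // => k kg.
  by rewrite indicE memNset ?mulr0 //= => gk; rewrite gk eqxx in kg.
have I1 k : mu.-integrable setT (EFin \o (\1_(g @^-1` [set k]) : B -> R)).
  exact: integrable_indic.
have Ia k : mu.-integrable setT (fun y : B => (a k * \1_(g @^-1` [set k]) y)%:E).
  by under eq_fun do rewrite EFinM; apply: integrableZl => //; exact: I1.
have aE' : (fun y : B => (a (g y))%:E) =
    (fun y => \sum_k (a k * \1_(g @^-1` [set k]) y)%:E)%E.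
  by apply/funext => y; rewrite aE sumEFin.
split; first by rewrite /comp aE'; exact: integrable_sum.
rewrite /Rintegral aE' integral_sum //.
rewrite -sum_fine => [|k _]; last exact: integrable_fin_num.
apply: eq_bigr => k _; rewrite -[LHS]/(\int[mu]_y (a k * \1_(g @^-1` [set k]) y)).
by rewrite RintegralZl // /Rintegral integral_indic // setIT.
Qed.

Definition mass mu : R := fine (mu setT).

Lemma mass_ge0 mu : 0 <= mass mu. Proof. exact: fine_ge0. Qed.

Definition cell mu n (g : T -> 'I_n) (k : 'I_n) : R := fine (mu (g @^-1` [set k])).

Lemma cell_ge0 mu n (g : T -> 'I_n) k : 0 <= cell mu n g k. Proof. exact: fine_ge0. Qed.

Lemma sum_cell mu n (g : T -> 'I_n) :
  (forall k, measurable (g @^-1` [set k] : set B)) -> \sum_k cell mu n g k = mass mu.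
Proof.
move=> mg; have [_] := net_integral n g (fun=> 1) mu mg.
rewrite Rintegral_cst // mul1r => h; apply: etrans (esym h).
by apply: eq_bigr => k _; rewrite mul1r.
Qed.

(** The sum is the integral of [f \o x \o g], which is within [c * e] of [f] pointwise. *)
Lemma lip_net_integral c e n x g f mu : lip c f -> 0 <= c -> @net e n x g ->
  `|\int[mu]_y f y - \sum_k f (x k) * cell mu n g k| <= c * e * mass mu.
Proof.
move=> fL c0 [mg xg].
have [Ia <-] := net_integral n g (f \o x) mu mg.
have If := lip_integrable c f mu fL.
rewrite -RintegralB //.
have Ifa : mu.-integrable setT (EFin \o (fun y : B => f y - (f \o x) (g y))).
  by under [X in _.-integrable _ X]eq_fun do rewrite /= EFinB; exact: integrableB.
apply: (le_trans (le_normr_Rintegral _ _)) => //.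
rewrite -Rintegral_cst //; apply: le_Rintegral => //.
- exact: integrable_norm.
- by apply/finite_measure_integrable_cst.
- move=> y _; apply: (le_trans (fL _ _)); rewrite ler_wpM2l // dC.
  exact: ltW.
Qed.

(** * Potentials and the form [Wpos] *)

Definition potential mu (x : T) : R := \int[mu]_y expR (- d x y).

Lemma expRNd_lip x : lip 1 (fun y => expR (- d x y)).
Proof.
move=> y z; rewrite mul1r; apply: (le_trans (expRN_lip _ _ _ _)) => //.
by rewrite ler_norml; apply/andP; split;
  have := d_tri x y z; have := d_tri x z y; rewrite (dC z y); lra.
Qed.

Lemma expRNd_integrable mu x :
  mu.-integrable setT (EFin \o (fun y : B => expR (- d x y))).
Proof. exact: lip_integrable (expRNd_lip x). Qed.

(** Allows the net estimate to be applied again, to the outer integral of [Wpos]. *)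
Lemma potential_lip mu : lip (mass mu) (potential mu).
Proof.
move=> x y.
rewrite /potential -RintegralB //; try exact: expRNd_integrable.
have Id : mu.-integrable setT (EFin \o (fun z : B => expR (- d x z) - expR (- d y z))).
  by under [X in _.-integrable _ X]eq_fun do rewrite /= EFinB;
    apply: integrableB => //; exact: expRNd_integrable.
apply: (le_trans (le_normr_Rintegral _ _)) => //.
rewrite mulrC -Rintegral_cst //; apply: le_Rintegral => //.
- exact: integrable_norm.
- by apply/finite_measure_integrable_cst.
- by move=> z _; have := expRNd_lip z x y; rewrite mul1r (dC z x) (dC z y).
Qed.

Lemma Wpos_potential mu nu : Wpos mu nu = \int[mu]_x potential nu x.
Proof.
congr fine; apply: eq_integral => x _; rewrite /potential /Rintegral fineK //.
exact: integrable_fin_num (expRNd_integrable nu x).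
Qed.

(** The form [Wpos] after the mass of each cell has been moved to its centre. *)
Definition net_form mu nu n (x : 'I_n -> T) (g : T -> 'I_n) : R :=
  \sum_k \sum_l cell mu n g k * cell nu n g l * expR (- d (x k) (x l)).

(** The factor 2 counts two discretizations, of the outer and of the inner integral; [s] is the
    intermediate stage with only the outer one replaced. *)
Lemma Wpos_net e n x g mu nu : @net e n x g ->
  `|Wpos mu nu - net_form mu nu n x g| <= e * (2 * mass mu * mass nu).
Proof.
move=> xg; have [mg _] := xg.
rewrite Wpos_potential /net_form.
pose s := \sum_k potential nu (x k) * cell mu n g k.
have h1 := lip_net_integral _ e n x g _ mu (potential_lip nu) (mass_ge0 nu) xg.
have h2 : `|s - net_form mu nu n x g| <= mass mu * (e * mass nu).
  rewrite /s /net_form -sumrB -(sum_cell mu n g mg) mulr_suml.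
  apply: (le_trans (ler_norm_sum _ _ _)); apply: ler_sum => k _.
  have -> : \sum_l cell mu n g k * cell nu n g l * expR (- d (x k) (x l)) =
      cell mu n g k * \sum_l expR (- d (x k) (x l)) * cell nu n g l.
    by rewrite mulr_sumr; apply: eq_bigr => l _; ring.
  rewrite mulrC -mulrBr normrM ger0_norm ?cell_ge0 // ler_wpM2l ?cell_ge0 //.
  have := lip_net_integral _ e n x g _ nu (expRNd_lip (x k)) ler01 xg.
  by rewrite mul1r.
rewrite -/(net_form mu nu n x g).
have := ler_distD s (\int[mu]_x potential nu x) (net_form mu nu n x g).
rewrite -/s in h1; move: h1 h2; lra.
Qed.

(** Fubini's theorem is replaced by the symmetry of the approximating finite sums. *)
Lemma Wpos_sym mu nu : Wpos mu nu = Wpos nu mu.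
Proof.
apply/eqP; rewrite -subr_eq0; apply/eqP.
apply: (eq0_small _ (4 * mass mu * mass nu)) => e /ex_net[n [x [g xg]]].
have h1 := Wpos_net _ _ _ _ mu nu xg; have h2 := Wpos_net _ _ _ _ nu mu xg.
have E : net_form nu mu n x g = net_form mu nu n x g.
  rewrite /net_form exchange_big; apply: eq_bigr => k _; apply: eq_bigr => l _.
  by rewrite dC mulrAC; ring.
rewrite E distrC in h2.
by have := ler_distD (net_form mu nu n x g) (Wpos mu nu) (Wpos nu mu); lra.
Qed.

(** A combination of measures discretizes to the combination of its cell masses, so this is a
    quadratic form of the kernel on the centres. *)
Lemma net_form_combination {I : finType} (a : I -> R)
    (mu : I -> {finite_measure set B -> \bar R}) n x g :
  \sum_i \sum_j a i * a j * net_form (mu i) (mu j) n x g =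
  \sum_k \sum_l (\sum_i a i * cell (mu i) n g k) *
    (\sum_i a i * cell (mu i) n g l) * expR (- d (x k) (x l)).
Proof.
rewrite /net_form.
under eq_bigr => i _ do under eq_bigr => j _ do rewrite mulr_sumr.
under eq_bigr => i _ do rewrite exchange_big.
rewrite exchange_big; apply: eq_bigr => k _.
under eq_bigr => i _ do under eq_bigr => j _ do rewrite mulr_sumr.
under eq_bigr => i _ do rewrite exchange_big.
rewrite exchange_big; apply: eq_bigr => l _.
rewrite !mulr_suml; apply: eq_bigr => i _.
rewrite mulr_sumr mulr_suml; apply: eq_bigr => j _; ring.
Qed.

Lemma Wpos_combination_net {I : finType} (a : I -> R)
    (mu : I -> {finite_measure set B -> \bar R}) e n x g : @net e n x g ->
  `|\sum_i \sum_j a i * a j * Wpos (mu i) (mu j) -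
    \sum_i \sum_j a i * a j * net_form (mu i) (mu j) n x g| <=
  e * \sum_i \sum_j `|a i * a j| * (2 * mass (mu i) * mass (mu j)).
Proof.
move=> xg; rewrite -sumrB mulr_sumr.
apply: (le_trans (ler_norm_sum _ _ _)); apply: ler_sum => i _.
rewrite -sumrB mulr_sumr.
apply: (le_trans (ler_norm_sum _ _ _)); apply: ler_sum => j _.
rewrite -mulrBr normrM mulrCA ler_wpM2l //; exact: Wpos_net.
Qed.

Lemma Wpos_psd {I : finType} (a : I -> R)
    (mu : I -> {finite_measure set B -> \bar R}) : negative_type d ->
  0 <= \sum_i \sum_j a i * a j * Wpos (mu i) (mu j).
Proof.
move=> d_neg; apply/ler_addgt0Pr => e e0.
set C := \sum_i \sum_j `|a i * a j| * (2 * mass (mu i) * mass (mu j)).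
have C0 : 0 <= C.
  by apply: sumr_ge0 => i _; apply: sumr_ge0 => j _; rewrite !mulr_ge0 ?mass_ge0.
have C1 : 0 < C + 1 by lra.
(* The fineness is such that the total error, at most [e / (C + 1) * C], stays below [e], also when
   [C = 0]. *)
have [n [x [g xg]]] := ex_net (e / (C + 1)) (divr_gt0 e0 C1).
have := Wpos_combination_net a mu _ _ _ _ xg; rewrite net_form_combination -/C.
have := psd_expRN_negative_type d x d_metric d_neg
  (fun k => \sum_i a i * cell (mu i) n g k).
set u := \sum_k _; set w := \sum_i _ => u0.
have : e / (C + 1) * C <= e by rewrite mulrAC ler_pdivrMr // ler_pM2l //; lra.
by rewrite ler_norml => h /andP[]; lra.
Qed.

(** * Mixtures and Dirac measures *)

(** On a net both sides depend only on cell masses, where [nuE] applies; the discretization error is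
    then sent to 0. *)
Lemma Rintegral_mix {I : finType} (p : I -> R)
    (mu : I -> {finite_measure set B -> \bar R}) nu c f : lip c f -> 0 <= c ->
  (forall A : set B, measurable A -> fine (nu A) = \sum_i p i * fine (mu i A)) ->
  \int[nu]_y f y = \sum_i p i * \int[mu i]_y f y.
Proof.
move=> fL c0 nuE; apply/eqP; rewrite -subr_eq0; apply/eqP.
apply: (eq0_small _ (c * mass nu + \sum_i `|p i| * (c * mass (mu i)))).
move=> e /ex_net[n [x [g xg]]].
have h1 := lip_net_integral c e n x g f nu fL c0 xg.
have E : \sum_k f (x k) * cell nu n g k =
    \sum_i p i * \sum_k f (x k) * cell (mu i) n g k.
  under [RHS]eq_bigr do rewrite mulr_sumr.
  rewrite exchange_big; apply: eq_bigr => k _.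
  rewrite /cell nuE; last by case: xg.
  by rewrite mulr_sumr; apply: eq_bigr => i _; rewrite mulrCA.
have h2 : `|\sum_i p i * \int[mu i]_y f y - \sum_k f (x k) * cell nu n g k| <=
    e * \sum_i `|p i| * (c * mass (mu i)).
  rewrite E -sumrB mulr_sumr; apply: (le_trans (ler_norm_sum _ _ _)).
  apply: ler_sum => i _; rewrite -mulrBr normrM mulrCA ler_wpM2l // mulrCA mulrA.
  exact: lip_net_integral.
rewrite distrC in h2.
have := ler_distD (\sum_k f (x k) * cell nu n g k) (\int[nu]_y f y)
  (\sum_i p i * \int[mu i]_y f y).
move: h1 h2; rewrite (mulrC c e) -mulrA; lra.
Qed.

Lemma potential_mix {I : finType} (p : I -> R)
    (mu : I -> {finite_measure set B -> \bar R}) nu x :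
  (forall A : set B, measurable A -> fine (nu A) = \sum_i p i * fine (mu i A)) ->
  potential nu x = \sum_i p i * potential (mu i) x.
Proof. by move=> nuE; exact: Rintegral_mix (expRNd_lip x) ler01 nuE. Qed.

Lemma Wpos_mix {I : finType} (p : I -> R)
    (mu : I -> {finite_measure set B -> \bar R}) nu :
  (forall A : set B, measurable A -> fine (nu A) = \sum_i p i * fine (mu i A)) ->
  Wpos nu nu = \sum_i \sum_j p i * p j * Wpos (mu i) (mu j).
Proof.
move=> nuE.
have W1 m : Wpos nu m = \sum_i p i * Wpos (mu i) m.
  rewrite Wpos_potential; under eq_bigr do rewrite Wpos_potential.
  exact: Rintegral_mix (potential_lip m) (mass_ge0 m) nuE.
rewrite W1; apply: eq_bigr => i _.
rewrite Wpos_sym W1 mulr_sumr; apply: eq_bigr => j _.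
by rewrite Wpos_sym mulrA.
Qed.

Lemma Rintegral_dirac c f x : lip c f -> \int[\d_(x : B)]_y f y = f x.
Proof.
move=> fL; rewrite /Rintegral integral_dirac //; last first.
  by apply/measurable_EFinP; exact: lip_measurable fL.
by rewrite diracT mul1e.
Qed.

Lemma potential_dirac x y : potential (\d_(x : B)) y = expR (- d y x).
Proof. by rewrite /potential (Rintegral_dirac 1) //; exact: expRNd_lip. Qed.

Lemma Wpos_dirac x mu : Wpos (\d_(x : B)) mu = potential mu x.
Proof.
by rewrite Wpos_potential (Rintegral_dirac (mass mu)) //; exact: potential_lip.
Qed.

Lemma mass_probability (P : probability B R) : mass P = 1.
Proof. exact: (congr1 (@fine R) (probability_setT P)). Qed.

(** * The support of a probability measure *)

Lemma msupport_closed (P : probability B R) : d_closed d (msupport P).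
Proof.
move=> x /= /existsNP[e /not_implyP[e0 xe]]; exists (e / 2).
split; first by rewrite divr_gt0.
move=> y; rewrite /dball /= => xy /(_ (e / 2)) ye; apply: xe.
apply: (lt_le_trans (ye _)); first by rewrite divr_gt0.
apply: le_measure; rewrite ?inE; try exact: d_open_measurable (dball_open _ _).
move=> z; rewrite /dball /= => yz; have := d_tri x y z; lra.
Qed.

(** Each point off the support has a null ball, and this ball contains the whole cell of the point
    in a fine enough net. The null cells of countably many nets thus cover the complement. *)
Lemma msupport_full (P : probability B R) : prob_on (msupport P) P.
Proof.
have mC : measurable (~` msupport P : set B).
  by apply: d_open_measurable; exact: msupport_closed.
apply/negligibleP => //.
have cover (N : nat) : exists A : set B, P.-negligible A /\
    forall x e, P (dball d x e) = 0%E -> 2 * N.+1%:R^-1 <= e -> A x.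
  have [|n [x [g [mg xg]]]] := ex_net N.+1%:R^-1; first by rewrite invr_gt0.
  (* [F m] is the [m]-th cell if that cell is null, and empty otherwise. *)
  pose F m : set B := [set y | (g y : nat) = m /\ P (g @^-1` [set g y]) = 0%E].
  exists (\bigcup_m F m); split.
    apply: negligible_bigcup => m.
    have [[y [ym y0]]|F0] := pselect (exists y, F m y).
      have Fcell : F m `<=` g @^-1` [set g y].
        by move=> z [zm _] /=; apply: val_inj; rewrite /= zm ym.
      by apply: (negligibleS Fcell); exact/negligibleP.
    have Fm0 : F m `<=` set0 by move=> y Fy; apply: F0; exists y.
    by apply: (negligibleS Fm0); exact: negligible_set0.
  move=> y e ye Ne; exists (g y) => //; split => //.
  (* Two points of one cell are less than [2 / (N + 1)] apart, so the cell of [y] lies in the null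
     ball. *)
  apply: (@subset_measure0 _ _ _ P _ (dball d y e)) => //.
    exact: d_open_measurable (dball_open _ _).
  move=> z; rewrite /dball /= => zy; have := xg y; have := xg z; rewrite zy => h1 h2.
  have := d_tri y (x (g y)) z; move: Ne h1 h2; rewrite (dC y (x _)); move: (N.+1%:R^-1) => r; lra.
have [A AP] := choice cover.
suff sub : (~` msupport P : set B) `<=` \bigcup_N A N.
  by apply: (negligibleS sub); apply: negligible_bigcup => N; case: (AP N).
move=> x /= /existsNP[e /not_implyP[e0 xe]].
have [|N] := @ltr_add_invr _ 0 (e / 2); first by rewrite divr_gt0.
move=> Ne; exists N => //; apply: (proj2 (AP N)) (e) _ _; last first.
  by move: Ne; rewrite add0r; move: (N.+1%:R^-1) => r; lra.
by apply/eqP; rewrite eq_le measure_ge0 andbT leNgt; exact/negP.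
Qed.

(** * Constant potentials and magnitude *)

(** The diameter is at most [2 * C], so the kernel is bounded below by [expR (- (2 * C))].
    Positivity is what makes comparing energies equivalent to comparing their inverses. *)
Lemma Wprob_gt0 (P : probability B R) : 0 < Wprob P P.
Proof.
have x0L : lip 1 (d point).
  move=> y z; rewrite mul1r ler_norml; apply/andP; split.
    by have := d_tri point y z; lra.
  by have := d_tri point z y; rewrite (dC z y); lra.
have [C dC0] := lip_bounded _ _ x0L.
have dC2 x y : d x y <= 2 * C.
  have := d_tri x point y; rewrite (dC x point).
  have := dC0 x; have := dC0 y; rewrite !ger0_norm //; lra.
have cst_le f c : lip c f -> (forall x, expR (- (2 * C)) <= f x) ->
    expR (- (2 * C)) <= \int[P]_x f x.
  move=> fL fC; have <- : \int[P]_x expR (- (2 * C)) = expR (- (2 * C)).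
    by rewrite Rintegral_cst // -[fine _]/(mass P) mass_probability mulr1.
  apply: le_Rintegral => //; first by apply/finite_measure_integrable_cst.
  exact: lip_integrable fL.
apply: lt_le_trans (expR_gt0 (- (2 * C))) _.
rewrite -[Wprob P P]/(Wpos P P) Wpos_potential.
apply: (cst_le _ _ (potential_lip P)) => x.
apply: (cst_le _ _ (expRNd_lip x)) => y.
by rewrite ler_expR lerN2.
Qed.

(* [potential P] has [P]-average [Wprob P P], so it cannot exceed it on a
   set of positive measure; continuity then reaches every support point. *)
Lemma potential_msupport (P : probability B R) :
  P [set x | potential P x < Wprob P P] = 0%E ->
  forall x, msupport P x -> potential P x = Wprob P P.
Proof.
move=> Plt; set q := Wprob P P in Plt *.
pose f (x : B) := potential P x - q.
have fL : lip 1 f.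
  move=> x y; rewrite /f opprB addrA subrK -(mass_probability P).
  exact: potential_lip.
have fI := lip_integrable 1 f P fL.
have mf : measurable_fun setT (EFin \o f) by apply/measurable_EFinP; exact: lip_measurable fL.
have mlt : measurable ([set x | potential P x < q] : set B).
  rewrite [X in measurable X](_ : _ = f @^-1` `]-oo, 0[%classic); last first.
    by apply/seteqP; split => x; rewrite /= in_itv /= subr_lt0.
  rewrite -[X in measurable X]setTI; exact: (lip_measurable _ _ fL).
have f0 : (\int[P]_x (f x)%:E = 0)%E.
  rewrite -[LHS]fineK; last exact: integrable_fin_num.
  rewrite -[fine _]/(\int[P]_x (potential P x - q)) RintegralB //.
  - rewrite -Wpos_potential Rintegral_cst //.
    by rewrite -[fine _]/(mass P) mass_probability mulr1 -[Wpos P P]/q subrr.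
  - exact: lip_integrable (potential_lip P).
  - by apply/finite_measure_integrable_cst.
(* Almost everywhere [f >= 0], so its zero integral is also that of [|f|], and [f] vanishes almost
   everywhere. *)
have absf0 : (\int[P]_x `|(f x)%:E| = 0)%E.
  rewrite -f0; apply: ae_eq_integral => //; first exact: measurableT_comp.
  exists [set x | potential P x < q]; split => // x /= /not_implyP[_ fx].
  rewrite ltNge; apply/negP => qx; apply: fx.
  by rewrite /= ger0_norm // subr_ge0.
have [/(_ absf0) [N [mN N0 subN]] _] := ae_eq_integral_abs P measurableT mf.
move=> x xP; apply/eqP/negPn/negP => xq.
have fx0 : 0 < `|f x| by rewrite normr_gt0 subr_eq0.
(* As [f] is 1-Lipschitz, it has no zero in the ball of radius [|f x|] about [x]; that ball would be
   null, although [x] is in the support. *)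
have := xP _ fx0; rewrite ltNge => /negP; apply; rewrite -N0.
apply: le_measure; rewrite ?inE //; first exact: d_open_measurable (dball_open _ _).
move=> y; rewrite /dball /= => xy; apply: subN => /= /(_ Logic.I) [fy0].
by have := fL x y; rewrite mul1r fy0 subr0 leNgt xy.
Qed.

Lemma Wpos_mzero mu : Wpos (mzero : {finite_measure set B -> \bar R}) mu = 0.
Proof. by rewrite Wpos_potential /Rintegral integral_measure_zero. Qed.

Lemma magnitude_potential (Y : set T) (P : probability B R) :
  negative_type d -> d_closed d Y -> prob_on Y P ->
  (forall x, Y x -> potential P x = Wprob P P) ->
  magnitude d Y = ((Wprob P P)^-1)%:E.
Proof.
move=> d_neg Ycl PY hY; have q0 := Wprob_gt0 P; set q := Wprob P P in hY q0 *.
apply/le_anti/andP; split; last first.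
  (* [P] itself competes for the magnitude, as the signed measure [P - 0]. *)
  apply: ereal_sup_ubound; exists (P : {finite_measure set B -> \bar R},
    mzero : {finite_measure set B -> \bar R}); last first.
    rewrite /W /= !Wpos_mzero (Wpos_sym P) Wpos_mzero.
    by rewrite !subr0 addr0.
  split; first by split.
  rewrite /smass /= -[fine (P _)]/(mass P) mass_probability.
  by rewrite /mzero /= subr0.
have mY : measurable (~` Y : set B) by exact: d_open_measurable.
have WY mu : mu (~` Y) = 0%E -> Wpos mu P = q * mass mu.
  move=> muY; rewrite Wpos_potential -Rintegral_cst //.
  congr fine; apply: ae_eq_integral => //.
    by apply/measurable_EFinP; exact: lip_measurable (potential_lip P).
  exists (~` Y); split => // x /= /not_implyP[_ xq] xY.
  by apply: xq; rewrite hY.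
apply: ge_ereal_sup => _ [m [[m1Y m2Y] m_mass] <-].
suff qW : q <= W m m by rewrite lee_fin lef_pV2 // posrE // (lt_le_trans q0).
(* Semidefiniteness at [m.1 - m.2 - P], that is, at [m - P]. *)
have := Wpos_psd (fun i : 'I_3 => nth 0 [:: 1; -1; -1] i)
  (fun i : 'I_3 => nth m.1 [:: m.1; m.2; P : {finite_measure set B -> \bar R}] i) d_neg.
rewrite !big_ord_recl !big_ord0 /=.
rewrite (Wpos_sym P m.1) (Wpos_sym P m.2) !WY //.
have qm : q * mass m.1 - q * mass m.2 = q by rewrite -mulrBr [_ - _]m_mass mulr1.
rewrite mass_probability /W; move: qm.
move: (q * _) (q * mass m.2) (Wpos m.1 m.1) (Wpos m.1 m.2) (Wpos m.2 m.1) (Wpos m.2 m.2).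
move=> a b w11 w12 w21 w22; lra.
Qed.

Lemma magnitude_msupport (P : probability B R) : negative_type d ->
  P [set x | potential P x < Wprob P P] = 0%E ->
  magnitude d (msupport P) = ((Wprob P P)^-1)%:E.
Proof.
move=> d_neg Plt; apply: magnitude_potential => //; first exact: msupport_closed.
- exact: msupport_full.
- exact: potential_msupport.
Qed.

(** * Energy minimizers and approximation by nets *)

Lemma potential_ge_minimal (P : probability B R) x :
  (forall Q : probability B R, Wprob P P <= Wprob Q Q) -> Wprob P P <= potential P x.
Proof.
(* The constant 1 is the energy of the Dirac measure at [x], as [d x x = 0]. *)
move=> Pmin; apply: (@le_first_variation _ _ _ 1) => t /andP[t0 t1].
pose p (i : 'I_2) : R := if i == ord0 then 1 - t else t.
pose mu (i : 'I_2) : probability B R := if i == ord0 then P else \d_(x : B).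
have p0 i : 0 <= p i by rewrite /p; case: ifP => _; rewrite ?subr_ge0 // ltW.
have p1 : \sum_i p i = 1 by rewrite !big_ord_recl big_ord0 /p /=; ring.
have [Q QE] := ex_mixture p mu p0 p1.
have := Pmin Q; rewrite -[Wprob Q Q]/(Wpos Q Q) (Wpos_mix p mu Q QE).
rewrite !big_ord_recl !big_ord0 /p /mu /=.
rewrite (Wpos_sym P) !Wpos_dirac potential_dirac dxx oppr0 expR0.
by rewrite -[Wpos P P]/(Wprob P P); congr (_ <= _); ring.
Qed.

(** [Q] minimizes the energy only among measures carried by the points [x i], so the potential is
    controlled only there. As [Q] charges nothing else, the bound holds [Q]-almost everywhere. *)
Lemma ex_discrete_minimal n (x : 'I_n -> T) (p0 : 'I_n -> R) : in_simplex p0 ->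
  exists Q : probability B R,
    (forall p, in_simplex p ->
      Wprob Q Q <= \sum_i \sum_j p i * p j * expR (- d (x i) (x j))) /\
    Q [set y | potential Q y < Wprob Q Q] = 0%E.
Proof.
move=> sp0; pose K i j := expR (- d (x i) (x j)).
have Ksym i j : K i j = K j i by rewrite /K dC.
have [p sp pmin] := ex_simplex_min K p0 sp0.
pose mu i : probability B R := \d_(x i : B).
have [Q QE] := ex_mixture p mu sp.1 sp.2.
have QW : Wprob Q Q = \sum_i \sum_j p i * p j * K i j.
  rewrite -[LHS]/(Wpos Q Q) (Wpos_mix p mu Q QE).
  by apply: eq_bigr => i _; apply: eq_bigr => j _; rewrite Wpos_dirac potential_dirac.
exists Q; split; first by rewrite QW.
have mlt : measurable ([set y | potential Q y < Wprob Q Q] : set B).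
  rewrite [X in measurable X](_ : _ = potential Q @^-1` `]-oo, Wprob Q Q[%classic); last first.
    by apply/seteqP; split => y; rewrite /= in_itv.
  rewrite -[X in measurable X]setTI; exact: (lip_measurable _ _ (potential_lip Q)).
have Qge k : Wprob Q Q <= potential Q (x k).
  rewrite (potential_mix p mu Q (x k) QE) QW.
  under [leRHS]eq_bigr do rewrite /mu potential_dirac.
  exact: simplex_min_gradient.
rewrite -[LHS]fineK; last exact: fin_num_measure.
rewrite QE // big1 // => i _; set A := [set y | _].
have xA : ~ A (x i) by rewrite /A /= ltNge => /negP; apply; exact: Qge.
have -> : mu i A = 0%E by rewrite -[LHS]/(((x i \in A)%:R)%:E) memNset.
by rewrite mulr0.
Qed.

Lemma diversity_maximizing_minimal (P Q : probability B R) :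
  diversity_maximizing P -> Wprob P P <= Wprob Q Q.
Proof.
move=> Pmax; have : (((Wprob Q Q)^-1)%:E <= ((Wprob P P)^-1)%:E)%E.
  by rewrite Pmax; apply: ereal_sup_ubound; exists Q.
by rewrite lee_fin lef_pV2 // posrE Wprob_gt0.
Qed.

Lemma positively_weighted_msupport (P : probability B R) : negative_type d ->
  P [set x | potential P x < Wprob P P] = 0%E ->
  positively_weighted d (msupport P).
Proof.
move=> d_neg Plt; exists P; split; first exact: msupport_full.
by rewrite magnitude_msupport.
Qed.

Lemma le_max_diversity_magnitude : negative_type d ->
  (max_diversity d <= ereal_sup
    [set magnitude d Y | Y in [set Y | d_closed d Y /\ positively_weighted d Y]])%E.
Proof.
move=> d_neg; apply: ge_ereal_sup => _ [P _ <-].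
set S := ereal_sup _; set w := Wprob P P.
have w0 : 0 < w by exact: Wprob_gt0.
have approx e : 0 < e -> (((w + e)^-1)%:E <= S)%E.
  (* For a probability measure the error in [Wpos_net] is twice the radius of the net, hence
     [e / 2]. *)
  move=> e0; have [|n [x [g xg]]] := ex_net (e / 2); first by rewrite divr_gt0.
  have [mg _] := xg.
  have sp : in_simplex (cell P n g).
    by split; [exact: cell_ge0|rewrite sum_cell // mass_probability].
  have [Q [Qmin Qlt]] := ex_discrete_minimal n x _ sp.
  have := Wpos_net _ _ _ _ P P xg; rewrite mass_probability !mulr1 ler_norml => /andP[h _].
  have Qw : Wprob Q Q <= w + e.
    apply: (le_trans (Qmin _ sp)); rewrite -/(net_form P P n x g).
    by move: h; rewrite -[Wpos P P]/w; lra.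
  apply: (@le_trans _ _ (magnitude d (msupport Q))).
    by rewrite magnitude_msupport // lee_fin lef_pV2 // posrE ?Wprob_gt0 // addr_gt0.
  apply: ereal_sup_ubound; exists (msupport Q) => //; split; first exact: msupport_closed.
  exact: positively_weighted_msupport.
(* The supremum is extended-valued: [+oo] is trivial and [-oo] contradicts [approx]. A finite value
   is positive, so inverses can be compared. *)
case: S approx => [s| |] approx; last 2 first.
- exact: leey.
- by have := approx 1 ltr01.
have s0 : 0 < s.
  have := approx 1 ltr01; rewrite lee_fin; apply: lt_le_trans.
  by rewrite invr_gt0 addr_gt0.
rewrite lee_fin -[s]invrK lef_pV2 ?posrE ?invr_gt0 //.
apply/ler_addgt0Pr => e e0; have := approx e e0.
by rewrite lee_fin -[s in _ <= s]invrK lef_pV2 // posrE ?invr_gt0 // addr_gt0.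
Qed.

End CompactMetric.

Theorem theorem2p5 (R : realType) (T : pointedType) (d : T -> T -> R) :
  is_metric d -> d_compact d -> negative_type d ->
  max_diversity d =
    ereal_sup [set magnitude d Y | Y in [set Y | d_closed d Y /\ positively_weighted d Y]] /\
  (forall P : probability (Borel d) R, diversity_maximizing P ->
     d_closed d (msupport P) /\ positively_weighted d (msupport P) /\
     magnitude d (msupport P) = max_diversity d).
Proof.
move=> d_metric d_cpt d_neg; split.
  apply/le_anti/andP; split; first exact: le_max_diversity_magnitude.
  (* The magnitude of a positively weighted set is the inverse energy of a probability measure,
     which competes in [max_diversity]. *)
  apply: ge_ereal_sup => _ [Y [_ [P [_ PY]]] <-].
  by rewrite -PY; apply: ereal_sup_ubound; exists P.
move=> P Pmax.
have Plt : P [set x | potential P x < Wprob P P] = 0%E.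
  (* For a global minimizer the potential bound holds at every point, so the exceptional set is
     empty. *)
  rewrite [X in P X](_ : _ = set0) ?measure0 //; apply/seteqP; split => // x /=.
  rewrite ltNge => /negP; apply; apply: potential_ge_minimal => // Q.
  exact: diversity_maximizing_minimal.
split; first exact: msupport_closed.
split; first exact: positively_weighted_msupport.
by rewrite magnitude_msupport.
Qed.
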